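(* Let $q$ satisfy the RDE $dq_t=f(q_t)\,dt+\sigma(q_t)\,d\mathbf{Z}_t$, $q_0=a$, driven by a geometric rough path $\mathbf{Z}$. Then the formation of the rough variational equation commutes with discretisation if the variational variable is solved using the tangent lift of the discretisation of $q$. That is, let $\{q_k\}$ be generated by $q_{k+1}=\mathcal{M}_{t_k,t_{k+1},S(Z)}(q_k)$, and let $\{\delta q_k\}$ be the discretisation of the variational equation $$d\,\delta q_t=\frac{\partial f}{\partial q}(q_t)\,\delta q_t\,dt+\frac{\partial\sigma}{\partial q}(q_t)\,\delta q_t\,d\mathbf{Z}_t,\qquad\delta q_0=\delta a,$$ defined by $\delta q_{k+1}=T_{q_k}\mathcal{M}_{t_k,t_{k+1},S(Z)}(\delta q_k)$. Then $\{\delta q_k\}$ coincides with the linearisation of the discrete solution with respect to a perturbation of the initial condition: if $\{q_k^\varepsilon\}$ is generated by the method $\mathcal{M}_{t_k,t_{k+1},S(Z)}$ from $q_0^\varepsilon=q_0+\varepsilon\,\delta q_0$, then $\delta q_k=\frac{d}{d\varepsilon}\big|_{\varepsilon=0}q_k^\varepsilon$ for all $k$.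
   Context: $\mathbf{Z}=(Z,\mathbb{Z})$ is a geometric $\alpha$-Hölder rough path in $\mathbb{R}^K$, $\alpha\in(\frac13,\frac12]$; $f\in C^\infty(\mathbb{R}^N,\mathbb{R}^N)$, $\sigma\in C^\infty(\mathbb{R}^N,\mathcal{L}(\mathbb{R}^K,\mathbb{R}^N))$; $Q=\mathbb{R}^N$; $\delta a=\delta q_0\in\mathbb{R}^N$. On a grid $\{t_k\}$, $\mathcal{M}_{t_k,t_{k+1},S(Z)}:Q\to Q$, $q_k\mapsto q_{k+1}$, denotes a one-step numerical method for the RDE that depends smoothly on the truncated signature of the rough path and on the vector fields $f$ and $\sigma$; it is therefore differentiable in its argument $q_k$. $T_{q_k}\mathcal{M}_{t_k,t_{k+1},S(Z)}:T_{q_k}Q\to T_{q_{k+1}}Q$ is its tangent lift (derivative) at $q_k$, used as the numerical method for $\delta q$. *)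

(* Defs.v *)
From HB Require Import structures.
From mathcomp Require Import all_boot all_order all_algebra.
From mathcomp Require Import all_classical all_reals all_analysis.

Set Implicit Arguments.
Unset Strict Implicit.
Unset Printing Implicit Defensive.

Import Order.TTheory GRing.Theory Num.Theory.
Import numFieldNormedType.Exports.

Local Open Scope classical_set_scope.
Local Open Scope ring_scope.

(* Vectors of R^n are row vectors 'rV[R]_n.  An element A of L(R^K, R^N) is the
   K x N matrix acting on the right, z |-> z *m A, so [row i A] is the image of
   the i-th basis vector.  All matrix norms are the library's max norms. *)

(* Intended for finite-dimensional U, where "all directional derivatives are
   C^(k-1)" is the usual recursive definition of C^k on the open set A. *)
Fixpoint Ck_on (R : realType) (U V : normedModType R) (A : set U) (k : nat)
    (F : U -> V) : Prop :=
  match k with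
  | 0 => forall x, A x -> {for x, continuous F}
  | k'.+1 => (forall x, A x -> differentiable F x) /\
             (forall v, Ck_on A k' (fun x => 'D_v F x))
  end.

Definition smooth (R : realType) (U V : normedModType R) (F : U -> V) : Prop :=
  forall k, Ck_on setT k F.

Definition smooth_near (R : realType) (U V : normedModType R) (F : U -> V)
    (x : U) : Prop :=
  exists2 A : set U, open_nbhs x A & forall k, Ck_on A k F.

Definition increment (V : zmodType) (R : Type) (Z : R -> V) (s t : R) : V :=
  Z t - Z s.

(* Two-parameter functions are only ever looked at on 0 <= s <= t <= T. *)
Definition holder2 (R : realType) (V : normedModType R) (T beta C : R)
    (X : R -> R -> V) : Prop :=
  forall s t, 0 <= s -> s <= t -> t <= T -> `|X s t| <= C * (t - s) `^ beta.

(* Second-level convention: ZZ s t i j = int_s^t (Z^i_r - Z^i_s) dZ^j_r. *)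
Definition rough_path (R : realType) (K : nat) (alpha T : R)
    (Z : R -> 'rV[R]_K) (ZZ : R -> R -> 'M[R]_K) : Prop :=
  [/\ exists C, holder2 T alpha C (increment Z),
      exists C, holder2 T (2 * alpha) C ZZ
    & forall s u t, 0 <= s -> s <= u -> u <= t -> t <= T ->
        ZZ s t = ZZ s u + ZZ u t + (increment Z s u)^T *m increment Z u t].

Definition canonical_lift (R : realType) (K : nat) (Y : R -> 'rV[R]_K)
    (s t : R) : 'M[R]_K :=
  \matrix_(i, j) \int[lebesgue_measure]_(r in `[s, t])
     ((Y r ord0 i - Y s ord0 i) * derive1 (fun u => Y u ord0 j) r).

(* Geometric: limit, in the alpha-Hölder rough path metric on [0, T], of
   canonical lifts of smooth paths. *)
Definition geometric_rough_path (R : realType) (K : nat) (alpha T : R)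
    (Z : R -> 'rV[R]_K) (ZZ : R -> R -> 'M[R]_K) : Prop :=
  rough_path alpha T Z ZZ /\
  exists Y : nat -> R -> 'rV[R]_K,
    (forall n, smooth (Y n : R^o -> 'rV[R]_K)) /\
    forall eps : R, 0 < eps -> \forall n \near \oo,
      holder2 T alpha eps (fun s t => increment (Y n) s t - increment Z s t) /\
      holder2 T (2 * alpha) eps (fun s t => canonical_lift (Y n) s t - ZZ s t).

(* The full signature S(Z), as coordinates indexed by words w = i1...ik:
   S s t w = int_{s<r1<...<rk<t} dZ^{i1} ... dZ^{ik}.  It is Lyons' unique
   extension of (Z, ZZ) to a multiplicative functional of the same regularity. *)
Definition is_signature (R : realType) (K : nat) (alpha T : R)
    (Z : R -> 'rV[R]_K) (ZZ : R -> R -> 'M[R]_K)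
    (S : R -> R -> seq 'I_K -> R) : Prop :=
  [/\ forall s t, 0 <= s -> s <= t -> t <= T ->
        [/\ S s t [::] = 1,
            forall i, S s t [:: i] = increment Z s t ord0 i
          & forall i j, S s t [:: i; j] = ZZ s t i j],
      forall s u t w, 0 <= s -> s <= u -> u <= t -> t <= T ->
        S s t w = \sum_(0 <= l < (size w).+1) S s u (take l w) * S u t (drop l w)
    & forall w, exists C, holder2 T ((size w)%:R * alpha) C
                            (fun s t => S s t w : R^o)].

(* T^(m)(R^K), one coordinate per word of length at most m. *)
Notation trunc_tensor R K m := ('rV[R]_(#|{: m.-bseq 'I_K}|)).

Definition truncate (R : realType) (K m : nat) (g : seq 'I_K -> R) :
    trunc_tensor R K m :=
  \row_l g (@enum_val (m.-bseq 'I_K) predT l).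

(* I is the limit of \sum Xi u v over the consecutive points u, v of partitions
   of [s, t] as the mesh tends to 0. *)
Definition partition_limit (R : realType) (V : normedModType R)
    (Xi : R -> R -> V) (s t : R) (I : V) : Prop :=
  forall eps : R, 0 < eps -> exists2 delta : R, 0 < delta &
    forall p : seq R, itv_partition s t p ->
      (forall l, (l < size p)%N -> nth t (s :: p) l.+1 - nth t (s :: p) l < delta) ->
      `|\sum_(l < size p) Xi (nth t (s :: p) l) (nth t (s :: p) l.+1) - I| <= eps.

(* Solution of dy = f(y) dt + \sum_i sigma_i(y) dZ^i, y_0 = a, on [0, T]:
   (y, sigma(y)) is controlled by Z, and the equation holds in integral form,
   with a Riemann integral and a (Gubinelli) rough integral.  The integrand
   sigma_j(y) has Gubinelli derivative (D sigma_j(y)) sigma_i(y). *)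
Definition rde_solution (R : realType) (K : nat) (V : normedModType R)
    (alpha T : R) (Z : R -> 'rV[R]_K) (ZZ : R -> R -> 'M[R]_K)
    (f : V -> V) (sigma : 'I_K -> V -> V) (a : V) (y : R -> V) : Prop :=
  [/\ exists C, holder2 T alpha C (increment y),
      exists C, holder2 T (2 * alpha) C (fun s t =>
        increment y s t - \sum_i increment Z s t ord0 i *: sigma i (y s))
    & forall t, 0 <= t -> t <= T -> exists I J : V,
        [/\ partition_limit (fun u v => (v - u) *: f (y u)) 0 t I,
            partition_limit (fun u v =>
              \sum_i increment Z u v ord0 i *: sigma i (y u) +
              \sum_i \sum_j ZZ u v i j *: 'd (sigma j) (y u) (sigma i (y u))) 0 t J
          & y t = a + I + J]].

Definition noise_field (R : realType) (K N : nat)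
    (sigma : 'rV[R]_N -> 'M[R]_(K, N)) (i : 'I_K) (x : 'rV[R]_N) : 'rV[R]_N :=
  row i (sigma x).

Definition tangent_field (R : realType) (V : normedModType R) (f : V -> V)
    (p : V * V) : V * V :=
  (f p.1, 'd f (p.1) p.2).

(* d dq = Df(q) dq dt + D sigma(q) dq dZ, dq_0 = da.  The rough integral needs
   the joint controlled structure of (q, dq), so the equation is read together
   with that of q, as the RDE for (q, dq) driven by the tangent fields. *)
Definition variational_solution (R : realType) (K : nat) (V : normedModType R)
    (alpha T : R) (Z : R -> 'rV[R]_K) (ZZ : R -> R -> 'M[R]_K)
    (f : V -> V) (sigma : 'I_K -> V -> V) (a : V) (y : R -> V)
    (da : V) (dy : R -> V) : Prop :=
  rde_solution alpha T Z ZZ (tangent_field f) (fun i => tangent_field (sigma i))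
    (a, da) (fun t => (y t, dy t)).

(* A one-step method on Q = R^N: from f, sigma, the grid points s and t, and a
   truncated signature, a map Q -> Q. *)
Definition method (R : realType) (K N m : nat) : Type :=
  ('rV[R]_N -> 'rV[R]_N) -> ('rV[R]_N -> 'M[R]_(K, N)) ->
  R -> R -> trunc_tensor R K m -> 'rV[R]_N -> 'rV[R]_N.

(* Smooth dependence on vector fields (an infinite-dimensional argument) is
   smoothness along every smooth finite-dimensional family (F_theta, G_theta)
   of vector fields, here jointly with the signature and the base point.  Only
   a neighbourhood of the given data is involved, so that methods which are
   meaningful only near them (e.g. implicit ones) are not excluded. *)
Definition depends_smoothly (R : realType) (K N m : nat) (M : method R K N m)
    (f : 'rV[R]_N -> 'rV[R]_N) (sigma : 'rV[R]_N -> 'M[R]_(K, N))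
    (s t : R) (g : trunc_tensor R K m) : Prop :=
  forall (d : nat) (F : 'rV[R]_d -> 'rV[R]_N -> 'rV[R]_N)
      (G : 'rV[R]_d -> 'rV[R]_N -> 'M[R]_(K, N)),
    smooth (fun p : 'rV[R]_d * 'rV[R]_N => F p.1 p.2) ->
    smooth (fun p : 'rV[R]_d * 'rV[R]_N => G p.1 p.2) ->
    F 0 = f -> G 0 = sigma ->
    forall q : 'rV[R]_N,
      smooth_near (fun p : 'rV[R]_d * trunc_tensor R K m * 'rV[R]_N =>
        M (F p.1.1) (G p.1.1) s t p.1.2 p.2) (0, g, q).

Definition is_grid (R : realType) (T : R) (n : nat) (t : nat -> R) : Prop :=
  [/\ t 0%N = 0, forall k, (k < n)%N -> t k < t k.+1 & t n <= T].

Definition grid_step (R : realType) (K N m : nat) (M : method R K N m)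
    (f : 'rV[R]_N -> 'rV[R]_N) (sigma : 'rV[R]_N -> 'M[R]_(K, N))
    (S : R -> R -> seq 'I_K -> R) (t : nat -> R) (k : nat) :
    'rV[R]_N -> 'rV[R]_N :=
  M f sigma (t k) (t k.+1) (truncate m (S (t k) (t k.+1))).

(* Main.v *)
Require Import Defs.
From HB Require Import structures.
From mathcomp Require Import all_boot all_order all_algebra.
From mathcomp Require Import all_classical all_reals all_analysis.

Set Implicit Arguments.
Unset Strict Implicit.
Unset Printing Implicit Defensive.

Import Order.TTheory GRing.Theory Num.Theory.
Import numFieldNormedType.Exports.

Local Open Scope classical_set_scope.
Local Open Scope ring_scope.

(** Once the truncated signature of each step is fixed, the discrete flow is a
    finite composition of maps [Phi_k] of [Q] to itself, so differentiating it
    in the initial condition is the chain rule.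

    The curve [eps |-> q_k^eps] satisfies [q_(k+1)^eps = Phi_k (q_k^eps)] and
    passes through [q_k] at [eps = 0].  If it is differentiable at [0] with
    velocity [dq_k], and [Phi_k] is differentiable at [q_k], then
    [q_(k+1)^eps] is differentiable with velocity [D Phi_k (q_k) dq_k], and this
    is the tangent-lift recursion that defines [dq_(k+1)]
    ([is_derive_iterated_maps]).

    What has to be extracted from the hypotheses is the differentiability of
    [Phi_k].  Smooth dependence of a method speaks of smooth families of vector
    fields; applied to the zero-parameter family consisting of [f] and [sigma]
    alone, it gives joint smoothness in the signature and the base point, and
    freezing the signature leaves a map differentiable in the base point
    ([depends_smoothly_differentiable]). *)

Lemma differentiable_snd (R : realType) (U V : normedModType R) (p : U * V) :
  differentiable (@snd U V) p.
Proof. by apply: linear_differentiable => x; apply: cvg_snd. Qed.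

(** Directional derivatives of [F \o snd] are again of this form, since
    ['D_v (F \o snd) p] has the very difference quotient of ['D_(v.2) F p.2];
    this closes the recursion over the order of smoothness. *)
Lemma smooth_comp_snd (R : realType) (U V W : normedModType R) (F : V -> W) :
  smooth F -> smooth (fun p : U * V => F p.2).
Proof.
move=> smoothF k; move: F {smoothF}(smoothF k).
elim: k => [|k IHk] F /=.
  move=> contF p _.
  by apply: (@continuous_comp _ _ _ snd F); [exact: cvg_snd|exact: contF].
move=> [diffF CkF]; split => [p _|v].
  by apply: (@differentiable_comp _ _ _ _ snd F); [exact: differentiable_snd|exact: diffF].
exact: (IHk (fun x => 'D_(v.2) F x) (CkF v.2)).
Qed.

Lemma smooth_near_differentiable (R : realType) (U V : normedModType R)
    (F : U -> V) (x : U) :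
  smooth_near F x -> differentiable F x.
Proof. by move=> [A [_ Ax] CF]; case: (CF 1%N) => diffF _; exact: diffF. Qed.

(** Uses the family indexed by ['rV_0], whose only member is the given pair of
    vector fields, and restricts to the slice through the given signature. *)
Lemma depends_smoothly_differentiable (R : realType) (K N m : nat)
    (M : method R K N m) (f : 'rV[R]_N -> 'rV[R]_N)
    (sigma : 'rV[R]_N -> 'M[R]_(K, N)) (s t : R) (g : trunc_tensor R K m)
    (q : 'rV[R]_N) :
  smooth f -> smooth sigma -> depends_smoothly M f sigma s t g ->
  differentiable (M f sigma s t g) q.
Proof.
move=> smooth_f smooth_sigma smooth_M.
have joint := smooth_near_differentiable (smooth_M 0%N (fun=> f) (fun=> sigma)
  (smooth_comp_snd _ smooth_f) (smooth_comp_snd _ smooth_sigma) erefl erefl q).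
apply: (differentiable_comp
  (f := fun x => ((0, g), x) : 'rV[R]_0 * trunc_tensor R K m * 'rV[R]_N) _ joint).
by apply: differentiable_pair; [exact: differentiable_cst|exact: ex_diff].
Qed.

(** The velocity of a differentiable curve is pushed forward by the
    differential.  Differentiability of the curve itself, rather than the
    existence of its derivative, is what the chain rule consumes; on the line
    the two agree. *)
Lemma is_derive_comp_curve (R : realType) (V W : normedModType R)
    (c : R^o -> V) (v : V) (F : V -> W) (x : R^o) :
  is_derive x (1 : R^o) c v -> differentiable F (c x) ->
  is_derive x (1 : R^o) (fun e => F (c e)) ('d F (c x) v).
Proof.
move=> [/derivable1_diffP dc <-] dF.
have dFc : differentiable (F \o c) x by exact: differentiable_comp.
split; first exact: diff_derivable.
by rewrite (deriveE _ dFc) (deriveE _ dc) diff_comp.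
Qed.

(** The chain rule iterated along a discrete orbit.  The bound [n] is there for
    maps known to be differentiable only at the points visited before step
    [n], and for orbits that obey the recursion only up to that step. *)
Lemma is_derive_iterated_maps (R : realType) (V : normedModType R) (n : nat)
    (Phi : nat -> V -> V) (q dq : nat -> V) (qe : R -> nat -> V) :
  (forall k, (k < n)%N -> differentiable (Phi k) (q k)) ->
  (forall k, (k < n)%N -> q k.+1 = Phi k (q k)) ->
  (forall k, (k < n)%N -> dq k.+1 = 'd (Phi k) (q k) (dq k)) ->
  (forall eps, qe eps 0%N = q 0%N + eps *: dq 0%N) ->
  (forall eps k, (k < n)%N -> qe eps k.+1 = Phi k (qe eps k)) ->
  forall k, (k <= n)%N ->
    is_derive (0 : R^o) (1 : R^o) (fun eps : R^o => qe eps k) (dq k).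
Proof.
move=> diffPhi qS dqS qe0 qeS.
have qe_at0 k : (k <= n)%N -> qe 0 k = q k.
  elim: k => [_|k IHk kn]; first by rewrite qe0 scale0r addr0.
  by rewrite qeS // qS // IHk // ltnW.
elim=> [_|k IHk kn].
  under eq_fun do rewrite qe0.
  have d0 : is_diff (0 : R^o) (cst (q 0%N) + ( *:%R^~ (dq 0%N)) : R^o -> V)
    (0 + ( *:%R^~ (dq 0%N)) : R^o -> V) by exact: is_diffD.
  split; first exact/diff_derivable/ex_diff.
  by rewrite (deriveE _ (@ex_diff _ _ _ _ _ _ _ d0)) diff_val /= add0r scale1r.
under eq_fun do rewrite qeS //.
rewrite dqS // -(qe_at0 k (ltnW kn)).
apply: is_derive_comp_curve; first exact: IHk (ltnW kn).
by rewrite qe_at0 ?(ltnW kn) //; exact: diffPhi.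
Qed.

Theorem proposition3p6 (R : realType) (K N : nat) (alpha T : R)
    (Z : R -> 'rV[R]_K) (ZZ : R -> R -> 'M[R]_K) (S : R -> R -> seq 'I_K -> R)
    (f : 'rV[R]_N -> 'rV[R]_N) (sigma : 'rV[R]_N -> 'M[R]_(K, N))
    (a da : 'rV[R]_N) (y dy : R -> 'rV[R]_N)
    (n : nat) (t : nat -> R) (m : nat) (M : method R K N m)
    (q dq : nat -> 'rV[R]_N) (qe : R -> nat -> 'rV[R]_N) :
  3^-1 < alpha -> alpha <= 2^-1 -> 0 < T ->
  geometric_rough_path alpha T Z ZZ ->
  is_signature alpha T Z ZZ S ->
  smooth f -> smooth sigma ->
  rde_solution alpha T Z ZZ f (noise_field sigma) a y ->
  variational_solution alpha T Z ZZ f (noise_field sigma) a y da dy ->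
  is_grid T n t ->
  (forall k, (k < n)%N ->
     depends_smoothly M f sigma (t k) (t k.+1) (truncate m (S (t k) (t k.+1)))) ->
  q 0%N = a -> (forall k, (k < n)%N -> q k.+1 = grid_step M f sigma S t k (q k)) ->
  dq 0%N = da -> (forall k, (k < n)%N ->
     dq k.+1 = 'd (grid_step M f sigma S t k) (q k) (dq k)) ->
  (forall eps, qe eps 0%N = q 0%N + eps *: dq 0%N) ->
  (forall eps k, (k < n)%N -> qe eps k.+1 = grid_step M f sigma S t k (qe eps k)) ->
  forall k, (k <= n)%N ->
    is_derive (0 : R^o) (1 : R^o) (fun eps : R^o => qe eps k) (dq k).
Proof.
move=> _ _ _ _ _ smooth_f smooth_sigma _ _ _ smooth_M _ qS _ dqS qe0 qeS.
apply: (@is_derive_iterated_maps R _ n (grid_step M f sigma S t) q) => // k kn.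
exact: depends_smoothly_differentiable (smooth_M k kn).
Qed.
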